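(* Let $n>1$, let $x \in K_n$ and let $i \in [n]$. Then \[ \mathcal{L}(x a_i) = \begin{cases} \mathcal{L}(x) - 1, & i = \mathcal{L}(x), \\ \mathcal{L}(x), & i \neq \mathcal{L}(x). \end{cases} \]
   Context: For a natural number $k$, $[k]=\{1,\dots,k\}$, and $[0]=\emptyset$. Kiselman's semigroup $K_n$ is the monoid, with unit element $e$, given by generators $a_1,\dots,a_n$ and relations $a_i^2=a_i$ for all $i\in[n]$, and $a_i a_j a_i = a_j a_i a_j = a_i a_j$ for all $1\le j<i\le n$. For $X\subseteq[n]$, write $X=\{i_1>i_2>\dots>i_k\}$ and set $e_X=a_{i_1}a_{i_2}\cdots a_{i_k}$, with $e_\emptyset=e$. For $X\subseteq[n]$, the deletion endomorphism $\overline{\partial}_X:K_n\to K_n$ is the unique monoid endomorphism with $\overline{\partial}_X(a_i)=a_i$ if $i\notin X$ and $\overline{\partial}_X(a_i)=e$ if $i\in X$. The level function $\mathcal{L}:K_n\to\{0,1,\dots,n\}$ is defined by \[ \mathcal{L}(x)=\min\{i\in\{0,1,\dots,n\}\mid \overline{\partial}_{[i]}(x)=e_{[n]\setminus[i]}\} \] (the set contains $n$, so the minimum exists). *)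

(* Defs.v *)
From HB Require Import structures.
From mathcomp Require Import all_boot.
From mathcomp Require Import monoid.
From mathcomp Require Import generic_quotient.
From mathcomp Require Import boolp.

Set Implicit Arguments.
Unset Strict Implicit.
Unset Printing Implicit Defensive.

Local Open Scope group_scope.
Local Open Scope quotient_scope.

(* The index set [n] = {1, ..., n} is encoded as 'I_n: the ordinal i stands   *)
(* for the index i.+1, so that gen i is the generator a_(i+1).                *)

Inductive kis_rel (n : nat) : seq 'I_n -> seq 'I_n -> Prop :=
| kis_idem (i : 'I_n) : kis_rel [:: i; i] [:: i]
| kis_iji (i j : 'I_n) : j < i -> kis_rel [:: i; j; i] [:: i; j]
| kis_jij (i j : 'I_n) : j < i -> kis_rel [:: j; i; j] [:: i; j].

Inductive kis_congr (n : nat) : seq 'I_n -> seq 'I_n -> Prop :=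
| kis_rule u v : kis_rel u v -> kis_congr u v
| kis_refl u : kis_congr u u
| kis_sym u v : kis_congr u v -> kis_congr v u
| kis_trans v u w : kis_congr u v -> kis_congr v w -> kis_congr u w
| kis_cat u u' v v' :
    kis_congr u u' -> kis_congr v v' -> kis_congr (u ++ v) (u' ++ v').

Definition kis_eqb (n : nat) (u v : seq 'I_n) : bool := `[< kis_congr u v >].

Lemma kis_eqb_refl n : reflexive (@kis_eqb n).
Proof. by move=> u; apply/asboolP; exact: kis_refl. Qed.

Lemma kis_eqb_sym n : symmetric (@kis_eqb n).
Proof. by move=> u v; apply/asboolP/asboolP => /kis_sym. Qed.

Lemma kis_eqb_trans n : transitive (@kis_eqb n).
Proof.
by move=> v u w /asboolP uv /asboolP vw; apply/asboolP; exact: kis_trans vw.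
Qed.

Canonical kis_equiv n :=
  EquivRel (@kis_eqb n) (@kis_eqb_refl n) (@kis_eqb_sym n) (@kis_eqb_trans n).

Definition kiselman (n : nat) := {eq_quot kis_equiv n}.

HB.instance Definition _ n := Choice.on (kiselman n).
HB.instance Definition _ n := Quotient.on (kiselman n).

Section KiselmanMonoid.
Variable n : nat.
Implicit Types (x y z : kiselman n) (u v : seq 'I_n).

Definition kis_class u : kiselman n := \pi_(kiselman n) u.

Lemma kis_classP u v : kis_class u = kis_class v <-> kis_congr u v.
Proof.
split=> [/eqmodP /asboolP // | uv].
by apply/eqmodP/asboolP.
Qed.

Lemma kis_reprK x : kis_class (repr x) = x.
Proof. exact: reprK. Qed.

Definition kis_one : kiselman n := kis_class [::].
Definition kis_mul x y : kiselman n := kis_class (repr x ++ repr y).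

Lemma kis_mul_class u v :
  kis_mul (kis_class u) (kis_class v) = kis_class (u ++ v).
Proof. by apply/kis_classP/kis_cat; apply/kis_classP; rewrite kis_reprK. Qed.

Lemma kis_mulA : associative kis_mul.
Proof.
move=> x y z; rewrite -(kis_reprK x) -(kis_reprK y) -(kis_reprK z).
by rewrite !kis_mul_class catA.
Qed.

Lemma kis_mul1x : left_id kis_one kis_mul.
Proof. by move=> x; rewrite -(kis_reprK x) kis_mul_class. Qed.

Lemma kis_mulx1 : right_id kis_one kis_mul.
Proof. by move=> x; rewrite -(kis_reprK x) kis_mul_class cats0. Qed.

End KiselmanMonoid.

HB.instance Definition _ n := isMonoid.Build (kiselman n)
  (@kis_mulA n) (@kis_mul1x n) (@kis_mulx1 n).

Definition gen (n : nat) (i : 'I_n) : kiselman n := kis_class [:: i].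

Lemma kis_class_cat n (u v : seq 'I_n) :
  kis_class (u ++ v) = kis_class u * kis_class v.
Proof. by rewrite -kis_mul_class. Qed.

Lemma kis_class_prod n (u : seq 'I_n) : kis_class u = \prod_(i <- u) gen i.
Proof.
elim: u => [|i u IHu]; first by rewrite big_nil.
by rewrite big_cons -IHu -kis_class_cat.
Qed.

Lemma gen_idem n (i : 'I_n) : gen i * gen i = gen i.
Proof. by rewrite -kis_class_cat; apply/kis_classP/kis_rule/kis_idem. Qed.

Lemma gen_iji n (i j : 'I_n) : j < i -> gen i * gen j * gen i = gen i * gen j.
Proof.
move=> ji; rewrite /gen -(kis_class_cat [:: i] [:: j]) -(kis_class_cat [:: i; j] [:: i]) /=.
by apply/kis_classP/kis_rule/kis_iji.
Qed.

Lemma gen_jij n (i j : 'I_n) : j < i -> gen j * gen i * gen j = gen i * gen j.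
Proof.
move=> ji; rewrite /gen -(kis_class_cat [:: j] [:: i]) -(kis_class_cat [:: j; i] [:: j])
  -(kis_class_cat [:: i] [:: j]) /=.
by apply/kis_classP/kis_rule/kis_jij.
Qed.

(* enum X lists X in increasing order. *)
Definition e_ (n : nat) (X : {set 'I_n}) : kiselman n :=
  \prod_(i <- rev (enum X)) gen i.

Section Deletion.
Variables (n : nat) (X : {set 'I_n}).

Definition del_gen (i : 'I_n) : kiselman n := if i \in X then 1 else gen i.

Definition del (x : kiselman n) : kiselman n := \prod_(i <- repr x) del_gen i.

Lemma del_congr (u v : seq 'I_n) : kis_congr u v ->
  \prod_(i <- u) del_gen i = \prod_(i <- v) del_gen i.
Proof.
elim=> {u v} [u v|||v u w _ -> _ ->|u u' v v' _ IHu _ IHv] //; last first.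
  by rewrite !big_cat /= IHu IHv.
case=> [i|i j ji|i j ji]; rewrite !big_cons !big_nil !mulg1 /del_gen.
- by case: ifP => _; rewrite ?mulg1 ?gen_idem.
- by rewrite mulgA; do 2?case: ifP => _;
    rewrite ?mulg1 ?mul1g ?gen_idem ?gen_iji.
- by rewrite mulgA; do 2?case: ifP => _;
    rewrite ?mulg1 ?mul1g ?gen_idem ?gen_jij.
Qed.

Lemma del_class (u : seq 'I_n) : del (kis_class u) = \prod_(i <- u) del_gen i.
Proof. by apply/del_congr/kis_classP; rewrite kis_reprK. Qed.

Lemma del_monoid_morphism : monoid_morphism del.
Proof.
split=> [|x y]; first by rewrite (del_class [::]) big_nil.
rewrite -(kis_reprK x) -(kis_reprK y) -kis_class_cat !del_class.
by rewrite big_cat.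
Qed.

HB.instance Definition _ :=
  isUMagmaMorphism.Build (kiselman n) (kiselman n) del del_monoid_morphism.

Lemma del_genE (i : 'I_n) : del (gen i) = if i \in X then 1 else gen i.
Proof. by rewrite del_class big_seq1. Qed.

Lemma del_unique (f : kiselman n -> kiselman n) : monoid_morphism f ->
  (forall i, f (gen i) = if i \in X then 1 else gen i) -> f =1 del.
Proof.
move=> [f1 fM] fgen x; rewrite -(kis_reprK x) del_class.
elim: (repr x) => [|i u IHu]; first by rewrite big_nil.
by rewrite big_cons -cat1s kis_class_cat fM IHu fgen.
Qed.

End Deletion.

Section Level.
Variable n : nat.
Implicit Types (x : kiselman n) (k : 'I_n.+1).

(* The subset [k] = {1, ..., k} of [n]. *)
Definition initial (k : nat) : {set 'I_n} := [set j : 'I_n | j < k].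

Definition level x : 'I_n.+1 :=
  [arg min_(k < ord_max | del (initial k) x == e_ (~: initial k)) (k : nat)].

Lemma level_max x : del (initial n) x = e_ (~: initial n).
Proof.
have iT : initial n = setT by apply/setP => j; rewrite !inE ltn_ord.
rewrite iT setCT /e_ enum_set0 /rev /= big_nil /del big1 // => i _.
by rewrite /del_gen inE.
Qed.

Lemma del_level x : del (initial (level x)) x = e_ (~: initial (level x)).
Proof.
by rewrite /level; case: arg_minnP => [|k /eqP //]; apply/eqP/level_max.
Qed.

Lemma level_min x k :
  del (initial k) x = e_ (~: initial k) -> level x <= k.
Proof.
rewrite /level; case: arg_minnP => [|l _ lmin /eqP]; last exact: lmin.
exact/eqP/level_max.
Qed.

End Level.

(* Main.v *)
(** Write [z_k = a_n ... a_(k+1)], which satisfies [z_k a_i = z_k] for all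
    [i > k].  The set [{k | del_[k] x = z_k}], whose minimum is
    [level x], is compared with the corresponding set for [x a_i].  The only
    nontrivial point is that [x a_i] being in the set at [k] forces [x] to be
    so when [i <> k+1]: this uses the invariant sending a word over
    [a_(k+1), ..., a_n] to the product of the letters other than [a_(k+1)] that
    precede the last occurrence of [a_(k+1)]. *)
Require Import Defs.
From mathcomp Require Import all_boot.
From mathcomp Require Import monoid.

Set Implicit Arguments.
Unset Strict Implicit.
Unset Printing Implicit Defensive.

Section Level.
Local Open Scope group_scope.
Variable n : nat.
Implicit Types (i j k : 'I_n) (w u v : seq 'I_n) (x : kiselman n).

Local Notation z m := (@e_ n (~: initial n m)).

Lemma kis_class_cons i w : kis_class (i :: w) = gen i * kis_class w.
Proof. by rewrite -cat1s kis_class_cat. Qed.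

Lemma kis_class_rcons w i : kis_class (rcons w i) = kis_class w * gen i.
Proof. by rewrite -cats1 kis_class_cat. Qed.

Lemma del_filter (X : {set 'I_n}) w :
  del X (kis_class w) = kis_class [seq i <- w | i \notin X].
Proof.
rewrite del_class kis_class_prod big_filter [RHS]big_mkcond.
by apply: eq_bigr => i _; rewrite /del_gen if_neg.
Qed.

Lemma del_initial m w :
  del (initial n m) (kis_class w) = kis_class [seq i : 'I_n <- w | m <= i].
Proof.
by rewrite del_filter; congr kis_class; apply: eq_filter => i; rewrite inE -leqNgt.
Qed.

Lemma e_class (X : {set 'I_n}) : e_ X = kis_class (rev (enum X)).
Proof. by rewrite kis_class_prod. Qed.

Lemma enum_initialC k :
  enum (~: initial n k) = k :: enum (~: initial n k.+1).
Proof.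
pose r : rel 'I_n := fun i j => i < j.
have enum_sorted (X : {set 'I_n}) : sorted r (enum X).
  rewrite {1}/enum_mem; apply: sorted_filter => [? ? ?|]; first exact: ltn_trans.
  have := iota_ltn_sorted 0 n.
  by rewrite -val_enum_ord sorted_map enumT.
apply: (@irr_sorted_eq _ r) => // [? ? ?|i||i].
- exact: ltn_trans.
- exact: ltnn.
- rewrite /= path_min_sorted //; apply/allP => i.
  by rewrite mem_enum !inE -leqNgt.
by rewrite in_cons !mem_enum !inE -!leqNgt leq_eqVlt eq_sym.
Qed.

Lemma z_last k : z k = z k.+1 * gen k.
Proof. by rewrite !e_class enum_initialC rev_cons kis_class_rcons. Qed.

(** For [m < i], write [z m] as [z m.+1 * gen m], insert [gen i] after [z m.+1] by induction, and
    apply [gen_iji]; for [m = i] the last letter is idempotent. *)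
Lemma z_gen m i : m <= i -> z m * gen i = z m.
Proof.
have [d] := ubnPleq (i - m); elim: d m => [|d IHd] m le_d le_mi.
  have -> : m = i by apply/eqP; rewrite eqn_leq le_mi -subn_eq0 -leqn0.
  by rewrite z_last -mulgA gen_idem.
have [->|ne_mi] := eqVneq m i; first by rewrite z_last -mulgA gen_idem.
have lt_mi : m < i by rewrite ltn_neqAle ne_mi.
have lt_mn := ltn_trans lt_mi (ltn_ord i).
have zi : z m.+1 * gen i = z m.+1.
  by apply: IHd => //; rewrite subnS -ltnS (leq_trans _ le_d) // prednK // subn_gt0.
by rewrite (z_last (Ordinal lt_mn)) -{1}zi -!mulgA mulgA -(mulgA _ (gen i))
  !mulgA -(mulgA _ (gen i)) -(mulgA _ (gen i * _)) gen_iji // mulgA zi.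
Qed.

Lemma z_class m v : all (fun i : 'I_n => m <= i) v -> z m * kis_class v = z m.
Proof.
elim: v => [_|i v IHv /= /andP[le_mi /IHv zv]]; first exact: mulg1.
by rewrite kis_class_cons mulgA z_gen.
Qed.

(** By induction the final [gen k] yields a copy of itself before the tail of [w]; then [gen_jij] or
    idempotence removes the leading one. *)
Lemma gen_class_gen k w : all (fun i => k <= i) w ->
  gen k * kis_class w * gen k = kis_class w * gen k.
Proof.
elim: w => [_|i w IHw /= /andP[le_ki /IHw wk]]; first by rewrite mulg1 mul1g gen_idem.
rewrite kis_class_cons -!mulgA -wk !mulgA; congr (_ * _ * _).
move: le_ki; rewrite leq_eqVlt => /orP[/eqP/val_inj <-|lt_ki].
  by rewrite !gen_idem.
exact: gen_jij.
Qed.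

Lemma class_gen_filter k w : all (fun i => k <= i) w ->
  kis_class w * gen k = kis_class [seq i : 'I_n <- w | k < i] * gen k.
Proof.
elim: w => //= i w IHw /andP[le_ki w_ge].
move: le_ki; rewrite leq_eqVlt => /orP[/eqP/val_inj <-|lt_ki].
  by rewrite ltnn kis_class_cons gen_class_gen // IHw.
by rewrite lt_ki !kis_class_cons -!mulgA IHw.
Qed.

(* The letters greater than [k] before the last occurrence of [k], and [[::]]
   if [k] does not occur. *)
Fixpoint before_last k w : seq 'I_n :=
  if w is i :: w' then
    if k \in w' then
      if k < i then i :: before_last k w' else before_last k w'
    else [::]
  else [::].

Lemma before_last_cat k u v : before_last k (u ++ v) =
  if k \in v then [seq i : 'I_n <- u | k < i] ++ before_last k v else before_last k u.
Proof.
elim: u => [|i u IHu] /=; last first.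
  by rewrite mem_cat IHu; case: (k \in v); rewrite ?orbT ?orbF //; case: ifP.
case: ifP => // /negbT; case: v => //= i v.
by rewrite inE negb_or => /andP[_ /negPf ->].
Qed.

Lemma mem_congr u v : kis_congr u v -> u =i v.
Proof.
elim=> {u v} [u v|//|u v _ uv i|u v w _ uv _ vw i|u u' v v' _ uu _ vv i].
- by case=> [i|i j _|i j _] k; rewrite !inE; do 2?case: eqP.
- by rewrite uv.
- by rewrite uv.
by rewrite !mem_cat uu vv.
Qed.

Lemma filter_congr m u v : kis_congr u v ->
  kis_class [seq i : 'I_n <- u | m <= i] = kis_class [seq i : 'I_n <- v | m <= i].
Proof. by move/kis_classP => uv; rewrite -!del_initial uv. Qed.

(** The two sides of each relation have the same [before_last] as words. In a concatenation whose
    right factor contains [k], the left factor enters only through its letters above [k]: a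
    deletion, hence well defined on classes. *)
Lemma before_last_congr k u v : kis_congr u v ->
  kis_class (before_last k u) = kis_class (before_last k v).
Proof.
elim=> {u v} [u v|//|u v _ //|u v w _ -> _ //|u u' v v' cu IHu cv IHv].
  case=> [i|i j lt_ji|i j lt_ji]; rewrite /= !inE ?in_nil ?orbF.
  - by case: eqP => // ->; rewrite ltnn.
  - have [->|] := eqVneq k i; first by rewrite orbT ltnn ltnNge ltnW //= if_same.
    by have [->|] := eqVneq k j; rewrite ?lt_ji.
  have [->|] := eqVneq k j; first by rewrite orbT ltnn.
  rewrite orbF; have [->|] := eqVneq k i; last by [].
  by rewrite ltnNge (ltnW lt_ji).
rewrite !before_last_cat (mem_congr cv); case: ifP => // _.
by rewrite !kis_class_cat IHv (filter_congr _ cu).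
Qed.

(** Here [v] is what follows the last [k]; each earlier [k] is absorbed by the last one. *)
Lemma before_last_split k w : all (fun i => k <= i) w -> k \in w ->
  exists2 v, all (fun i => k <= i) v &
    kis_class w = kis_class (before_last k w) * gen k * kis_class v.
Proof.
elim: w => //= i w IHw /andP[le_ki w_ge]; rewrite inE.
have [k_w _|k_w] := boolP (k \in w); last first.
  by rewrite orbF => /eqP <-; exists w => //; rewrite kis_class_cons mul1g.
have [v v_ge def_w] := IHw w_ge k_w; exists v => //.
move: le_ki; rewrite leq_eqVlt => /orP[/eqP/val_inj <-|lt_ki]; last first.
  by rewrite lt_ki !kis_class_cons def_w !mulgA.
rewrite ltnn kis_class_cons def_w !mulgA; congr (_ * _).
apply: gen_class_gen; elim: (w) {IHw k_w def_w} w_ge => //= j u IHu /andP[le_kj /IHu].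
by do 2!case: ifP => //= _; rewrite le_kj.
Qed.

Lemma rcons_eq_z k w i : all (fun j => k <= j) w -> i != k ->
  kis_class (rcons w i) = z k -> kis_class w = z k.
Proof.
move=> w_ge ne_ik; rewrite e_class enum_initialC rev_cons => /kis_classP wi_z.
have k_w : k \in w.
  by have := mem_congr wi_z k; rewrite !mem_rcons !inE eqxx eq_sym (negPf ne_ik).
(* Appending [i != k] leaves [before_last k] unchanged, and for [z k] its class is [z k.+1]. Hence
   [w] represents [z k.+1 * gen k] times some [v], which [z k] absorbs. *)
have := before_last_congr k wi_z.
rewrite -!cats1 !before_last_cat !inE eqxx eq_sym (negPf ne_ik) cats0.
have -> : [seq j : 'I_n <- rev (enum (~: initial n k.+1)) | k < j]
          = rev (enum (~: initial n k.+1)).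
  by apply/all_filterP/allP => j; rewrite mem_rev mem_enum !inE -leqNgt.
rewrite -e_class => before_w; have [v v_ge ->] := before_last_split w_ge k_w.
by rewrite before_w -z_last z_class // z_last e_class -kis_class_rcons cats1.
Qed.

Definition levels x : pred nat := fun m => del (initial n m) x == z m.

Lemma levels_mul x i (m : nat) : m != i -> levels (x * gen i) m = levels x m.
Proof.
rewrite -(kis_reprK x) -kis_class_rcons /levels !del_initial filter_rcons => ne_mi.
(* If [i < m], the deletion erases the new letter and both conditions coincide. *)
case: ifP => // le_mi; have lt_mn := leq_ltn_trans le_mi (ltn_ord i).
apply/eqP/eqP => [|xm]; last by rewrite kis_class_rcons xm z_gen.
apply: (@rcons_eq_z (Ordinal lt_mn)); first exact: filter_all.
by rewrite -val_eqE eq_sym.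
Qed.

(** Deleting one more generator maps [z m] to [z m.+1]; from [m = n] on, everything is already
    deleted. *)
Lemma levelsS x m : levels x m -> levels x m.+1.
Proof.
have filterS u : [seq i : 'I_n <- [seq i : 'I_n <- u | m <= i] | m < i]
                 = [seq i : 'I_n <- u | m < i].
  by rewrite -filter_predI; apply: eq_filter => i /=; case: ltnP => // /ltnW.
have [lt_mn|le_nm] := ltnP m n; last first.
  have iE p : n <= p -> initial n p = setT.
    by move=> np; apply/setP => j; rewrite !inE (leq_trans (ltn_ord j)).
  by rewrite /levels !iE // leqW.
rewrite -(kis_reprK x) /levels !del_initial => /eqP.
move/(congr1 (del (initial n m.+1))); rewrite !del_initial filterS => ->.
rewrite (z_last (Ordinal lt_mn)) e_class -kis_class_rcons del_initial.
rewrite filter_rcons ltnn; apply/eqP; congr kis_class.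
by apply/all_filterP/allP => j; rewrite mem_rev mem_enum !inE -leqNgt.
Qed.

(** The final [gen i] absorbs all earlier ones, leaving the deletion at [i.+1] followed by [gen i],
    that is [z i.+1 * gen i]. *)
Lemma levels_mul_pred x i : levels x i.+1 -> levels (x * gen i) i.
Proof.
rewrite -(kis_reprK x) -kis_class_rcons /levels !del_initial filter_rcons leqnn.
move=> /eqP xi; rewrite kis_class_rcons class_gen_filter ?filter_all //.
rewrite -filter_predI z_last -xi; apply/eqP; congr (kis_class _ * _).
by apply: eq_filter => j /=; case: ltnP => // /ltnW.
Qed.

Lemma levels_level x : levels x (level x).
Proof. exact/eqP/del_level. Qed.

Lemma level_le x m : levels x m -> level x <= m.
Proof.
have [lt_mn /eqP xm|le_nm _] := ltnP m n; last exact: leq_trans (leq_ord _) le_nm.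
exact: (@level_min _ x (Ordinal (ltnW lt_mn : m < n.+1))).
Qed.

End Level.

Theorem theorem5p10 (n : nat) (hn : 1 < n) (x : kiselman n) (i : 'I_n) :
  (level (x * gen i)%g : nat) =
    if i.+1 == level x then level x - 1 else level x.
Proof.
have Lx := levels_level x; have Ly := levels_level (x * gen i)%g.
case: eqP => [eq_i|/eqP ne_i]; apply/eqP; rewrite eqn_leq.
  (* The set for the product gains [i]; below [i] it agrees with that of [x], which has nothing
     under [i.+1]. *)
  rewrite -eq_i subn1 /= level_le /=; last by rewrite levels_mul_pred // eq_i.
  rewrite leqNgt; apply/negP => lt_yi.
  move: Ly; rewrite levels_mul; last by rewrite ltn_eqF.
  by move/level_le; rewrite -eq_i leqNgt ltnW.
(* The two sets can differ only at [i]. If the new minimum is [i], then [i.+1] lies in both sets,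
   and [level x != i.+1] forces [level x <= i]. *)
have [eq_y|ne_y] := eqVneq (level (x * gen i)%g : nat) i.
  move: (levelsS Ly); rewrite eq_y levels_mul ?gtn_eqF // => /level_le.
  rewrite leq_eqVlt eq_sym (negPf ne_i) ltnS /= => le_xi; rewrite le_xi andbT.
  rewrite -eq_y level_le //.
  have [eq_x|ne_x] := eqVneq (level x : nat) i; first by rewrite eq_x -eq_y.
  by rewrite levels_mul.
rewrite [X in _ && X]level_le -?(levels_mul x ne_y) // andbT.
(* If the old minimum is [i], going up to [i.+1] and back down puts [i] in the new set. *)
have [eq_x|ne_x] := eqVneq (level x : nat) i; last by rewrite level_le ?levels_mul.
by rewrite eq_x; apply/level_le/levels_mul_pred/levelsS; rewrite -eq_x.
Qed.
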